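(* Let $h\in\omega^\omega$ be increasing, with $\limsup_n h(n)=\infty$. Then $f\mathcal{E}(h)$ is not an ideal of subsets of $\omega^\omega$.
   Context: $\forall^\infty n$ means ''for all but finitely many $n\in\omega$''. For $h\in\omega^\omega$ with $\limsup_n h(n)=\infty$, a set $F\subseteq\omega^\omega$ belongs to $f\mathcal{E}(h)$ if there are a partition $(I_n)_{n\in\omega}$ of $\omega$ into (nonempty, finite) intervals and a sequence $(J_n)_{n\in\omega}$ with $J_n\subseteq\omega^{I_n}$ and $\sum_{n\in\omega}\frac{|J_n|}{h(|I_n|)}<\infty$ such that $F\subseteq\{x\in\omega^\omega:(\forall^\infty n)(x\upharpoonright I_n\in J_n)\}$. Convention: $k/0=\infty$ for $k>0$ and $0/0=0$. An ideal is a family of sets closed under subsets and finite unions. *)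

(* Defs.v *)
From mathcomp Require Import all_boot all_order all_algebra finmap.
From mathcomp Require Import all_classical all_reals all_analysis.

Set Implicit Arguments.
Unset Strict Implicit.
Unset Printing Implicit Defensive.

Import Order.TTheory GRing.Theory Num.Theory.

Local Open Scope classical_set_scope.
Local Open Scope ring_scope.

(* The empty family is allowed, so an ideal contains set0. *)
Definition is_ideal (T : Type) (I : set (set T)) : Prop :=
  (forall A B : set T, A `<=` B -> I B -> I A) /\
  (forall S : set (set T), finite_set S -> S `<=` I -> I (\bigcup_(A in S) A)).

(* [partition] requires the blocks to be nonempty; they need not be listed in
   increasing order. *)
Definition interval_partition (I : nat -> set nat) : Prop :=
  classical_sets.partition setT I setT /\
  forall n, exists a b : nat, I n = [set k | (a <= k < b)%N].

(* The restriction of x to I n is [sigL (I n) x].  In the extended reals,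
   0^-1 = +oo and 0 * +oo = 0, so k / 0 = +oo for k > 0 and 0 / 0 = 0;
   [counting (J n)] is +oo if J n is infinite. *)
Definition fE (R : realType) (h : nat -> nat) : set (set (nat -> nat)) :=
  [set F | exists (I : nat -> set nat) (J : forall n, set (I n -> nat)),
    [/\ interval_partition I,
        (\sum_(n <oo)
           (counting (J n) / ((h #|` fset_set (I n)|)%:R)%:E : \bar R) < +oo)%E
      & F `<=` [set x | \forall n \near \oo, J n (sigL (I n) x)]]].

(* Main.v *)
Require Import Defs.
From mathcomp Require Import all_boot all_order all_algebra finmap.
From mathcomp Require Import all_classical all_reals all_analysis.
From mathcomp Require Import zify.

Set Implicit Arguments.
Unset Strict Implicit.
Unset Printing Implicit Defensive.

Import Order.TTheory GRing.Theory Num.Theory.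

Local Open Scope classical_set_scope.
Local Open Scope card_scope.
Local Open Scope ring_scope.

(** Two members of the family whose union is not a member are built from one
    sequence 0 = p 0 < p 1 < ... growing so fast that
    h (p (k+1) - p k) >= 2^(k+1) (h (p k) + 1) ([fast_growth]).

    One set uses the blocks [p (2i), p (2i+2)) and the other the block
    [0, p 1) followed by the blocks [p (2i-1), p (2i+1)) for i > 0.  In both
    cases the set consists of the functions that are constant on each block,
    with a value at most h (m_i), where m_i = p (2i+1) for the first set and
    m_i = p (2i) for the second is the last point of the sequence p in the
    i-th block.
    Such a block admits h (m_i) + 1 patterns and its length exceeds m_i by so
    much that the ratios are dominated by 2^-(i+1); so both sets belong to the
    family ([block_constant_fE]).

    Suppose that (K_n), (L_n) witness that the union belongs to it, and let e_n
    be the last point of K_n.  If e_n is large, it lies in some interval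
    [p k, p (k+1)), which is the part before the point m = m_i of a block
    of one of the two sets; which set it is depends on the parity of k.  Every
    value up to h m is taken at e_n by an element of that set, and these values
    can be chosen independently on different blocks, so for large n they must
    all appear at e_n in L_n; hence |L_n| > h m ([capture_block_constant]).
    But K_n is contained in [0, e_n], so |K_n| <= m and |L_n| > h (|K_n|):
    infinitely many terms of the series are at least 1, and it diverges. *)

(** * Unbounded functions and summable ratios *)

Lemma limn_esup_pinfty_unbounded (R : realType) (h : nat -> nat) :
  limn_esup (fun n => ((h n)%:R : R)%:E) = +oo%E ->
  forall B : nat, exists n, (B <= h n)%N.
Proof.
move=> hoo B; apply: contrapT => /forallNP hB.
suff : (limn_esup (fun n => ((h n)%:R : R)%:E) <= (B%:R)%:E)%E.
  by rewrite hoo leye_eq.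
rewrite /limn_esup limf_esupE; apply: ereal_inf_le.
exists (ereal_sup (range (fun n => ((h n)%:R : R)%:E))).
  by exists setT => //; exact: filterT.
apply: ge_ereal_sup => _ [n _ <-]; rewrite lee_fin ler_nat ltnW // ltnNge.
exact/negP/hB.
Qed.

(** The conventions for division make this uniform: when k = 0 the ratio is
    +oo unless A is empty. *)
Lemma counting_ratio_lt1 (R : realType) (T : choiceType) (A : set T) (k : nat) :
  (counting A / (k%:R)%:E < (1 : \bar R))%E -> A #<= `I_k.
Proof.
rewrite /counting; case: asboolP => [finA|_]; last first.
  rewrite inver; case: eqP => [_|/eqP k0]; first by rewrite mulyy.
  by rewrite gt0_mulye // lte_fin invr_gt0 lt0r k0 ler0n.
have /finite_setP[m Am] := finA.
rewrite (card_fset_set Am) (card_le_eql Am) card_le_II inver pnatr_eq0.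
case: eqVneq => [->|k0].
  case: m {Am} => // m.
  by rewrite gt0_muley ?lte_fin ?ltr0n.
by rewrite -EFinM lte_fin ltr_pdivrMr ?ltr0n ?lt0n // mul1r ltr_nat => /ltnW.
Qed.

Lemma counting_ratio_le (R : realType) (T : choiceType) (A : set T)
    (m k n : nat) : A #<= `I_m -> (0 < m)%N -> (2 ^ n * m <= k)%N ->
  (counting A / (k%:R)%:E <= (1 / (2 ^ n)%:R : R)%:E)%E.
Proof.
move=> Am m0 mk.
have finA : finite_set A by apply/finite_set_leP; exists m.
have k0 : (0 < k)%N by apply: leq_trans mk; rewrite muln_gt0 expn_gt0.
rewrite /counting; case: asboolP => // _.
rewrite inver pnatr_eq0 gtn_eqF // -EFinM lee_fin.
rewrite ler_pdivrMr ?ltr0n // mulrAC ler_pdivlMr ?ltr0n ?expn_gt0 //.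
rewrite mul1r -natrM ler_nat mulnC (leq_trans _ mk) // leq_mul2l.
by rewrite geq_card_fset_set ?orbT.
Qed.

Lemma counting_ge0 (R : realType) (T : choiceType) (A : set T) :
  (0 <= (counting A : \bar R))%E.
Proof. by rewrite /counting; case: asboolP => // _; rewrite leey. Qed.

(** The terms are dominated by the tails of the series, which tend to 0. *)
Lemma nneseries_lty_terms_lt (R : realType) (u : nat -> \bar R) (e : R) :
  (forall n, 0 <= u n)%E -> (\sum_(n <oo) u n < +oo)%E -> 0 < e ->
  exists N, forall n, (N <= n)%N -> (u n < e%:E)%E.
Proof.
move=> u0 uoo e0.
have tail0 := nneseries_tail_cvg uoo (fun k _ => u0 k).
have [N _ NP] := tail0 _ (open_ereal_lt' (e0 : (0 < e%:E)%E)).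
exists N => n /NP /=; apply: le_lt_trans.
have := nneseries_lim_ge (m := n) n.+1 (fun k _ (_ : xpredT k) => u0 k).
by rewrite big_nat1.
Qed.

(** The blocks of a partition come in no particular order; this turns a lower
    bound on a point of a block into a lower bound on the index of the block. *)
Lemma late_index_of_large_value (e : nat -> nat) (N : nat) :
  exists M, forall n, (M <= e n)%N -> (N <= n)%N.
Proof.
exists (\max_(i < N) e i).+1 => n; apply: contraTT; rewrite -!ltnNge => nN.
by rewrite ltnS; exact: (leq_bigmax (Ordinal nN)).
Qed.

(** * Functions that are constant on blocks *)

Lemma block_index (a : nat -> nat) (k : nat) :
  a 0%N = 0%N -> (forall i, (a i < a i.+1)%N) ->
  exists i, (a i <= k < a i.+1)%N.
Proof.
move=> a0 ai; elim: k => [|k [i ik]]; first by exists 0%N; have := ai 0%N; lia.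
have [?|?] := ltnP k.+1 (a i.+1); first by exists i; lia.
by exists i.+1; have := ai i.+1; lia.
Qed.

Lemma block_index_inj (a : nat -> nat) (i j k : nat) :
  (forall i, (a i < a i.+1)%N) -> (a i <= k < a i.+1)%N ->
  (a j <= k < a j.+1)%N -> i = j.
Proof.
move=> ai ik jk; have aM := homo_leq leqnn leq_trans (fun i => ltnW (ai i)).
by have [/aM|/aM|//] := ltngtP i j; lia.
Qed.

Definition block_constant (a c : nat -> nat) : set (nat -> nat) :=
  [set x | forall i, exists2 v, (v <= c i)%N &
     forall k, (a i <= k < a i.+1)%N -> x k = v].

Lemma block_constant_fE (R : realType) (h a c : nat -> nat) :
  a 0%N = 0%N -> (forall i, (a i < a i.+1)%N) ->
  (forall i, (2 ^ i.+1 * (c i).+1 <= h (a i.+1 - a i))%N) ->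
  fE R h (block_constant a c).
Proof.
move=> a0 ai hc.
pose I i := [set k | (a i <= k < a i.+1)%N].
pose J i := (fun v => cst v : I i -> nat) @` `I_(c i).+1.
have cardI i : #|` fset_set (I i)| = (a i.+1 - a i)%N.
  apply: card_fset_set; rewrite (_ : I i = `I_(a i.+1) `\` `I_(a i)).
    exact: card_IID.
  by apply/seteqP; split=> k; rewrite /I /=; lia.
exists I, J; split.
- split; last by move=> n; exists (a n), (a n.+1).
  split.
  + by rewrite -subTset => k _; have [i ik] := block_index k a0 ai; exists i.
  + by move=> i j _ _ [k [ik jk]]; exact: block_index_inj ai ik jk.
  + by move=> i _; exists (a i); rewrite /I /= leqnn ai.
- have le_geo i : (counting (J i) / ((h #|` fset_set (I i)|)%:R)%:E <=
                   (1 / (2 ^ i.+1)%:R : R)%:E)%E.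
    rewrite cardI; apply: counting_ratio_le (hc i) => //.
    exact: card_image_le.
  apply: le_lt_trans (ltry 1).
  apply: le_trans (epsilon_trick0 xpredT ler01); apply: lee_nneseries => // i _ _.
  by rewrite mule_ge0 ?counting_ge0 // inve_ge0 lee_fin ler0n.
- move=> x xF; apply: nearW => i; have [v vc xv] := xF i.
  exists v; first by rewrite /= ltnS.
  by apply/funext => k; rewrite /sigL /= xv //; exact: set_valP k.
Qed.

(** A diagonal argument.  Call n small if e n lies in a block i and L n has at
    most c i elements.  Then some value v <= c i is not taken at e n by any
    element of L n, and giving x the value v on block i expels x from the n-th
    constraint.  Several small n may compete for one block, so only one is
    served per block; a block far enough to the right serves a late n.  Hence
    small n with arbitrarily large e n would yield a block-constant x violating
    infinitely many constraints. *)
Lemma capture_block_constant (a c e : nat -> nat) (K : nat -> set nat)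
    (L : forall n, set (K n -> nat)) :
  a 0%N = 0%N -> (forall i, (a i < a i.+1)%N) -> (forall n, K n (e n)) ->
  block_constant a c `<=` [set x | \forall n \near \oo, L n (sigL (K n) x)] ->
  exists M, forall n i, (M <= e n)%N -> (a i <= e n < a i.+1)%N ->
    `I_(c i).+1 #<= L n.
Proof.
move=> a0 ai Ke FL.
pose ev n (z : K n -> nat) := z (exist _ (e n) (mem_set (Ke n))).
have aM := homo_leq leqnn leq_trans (fun i => ltnW (ai i)).
have ge_id i : (i <= a i)%N by elim: i => // i IH; have := ai i; lia.
pose small i n := (a i <= e n < a i.+1)%N /\ ~ (`I_(c i).+1 #<= L n).
have /choice[w wP] : forall i, exists v, (v <= c i)%N /\
    ((exists n, small i n) -> exists2 n, small i n & ~ (@ev n @` L n) v).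
  move=> i; have [[n sn]|no] := pselect (exists n, small i n); last first.
    by exists 0%N; split.
  suff [v vc vN] : exists2 v, (v <= c i)%N & ~ (@ev n @` L n) v.
    by exists v; split => // _; exists n.
  apply: contrapT => noV; apply: sn.2.
  apply: card_le_trans (card_image_le (@ev n) (L n)).
  apply: subset_card_le => v; rewrite /= ltnS => vc.
  by apply: contrapT => vN; apply: noV; exists v.
have /choice[idx idxP] k := block_index k a0 ai.
pose x k := w (idx k).
have [] : [set x | \forall n \near \oo, L n (sigL (K n) x)] x.
  apply: FL => i; exists (w i); first exact: (wP i).1.
  by move=> k ik; rewrite /x (block_index_inj ai (idxP k) ik).
move=> N _ NL.
have [B BP] := late_index_of_large_value e N.
(* Beyond a B lie only blocks of index i >= B, and i <= a i <= e m for each m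
   whose e m is in block i; so the m served by block i satisfies N <= m. *)
exists (a B) => n i Be ie; apply: contrapT => sm.
have [|m [mi _] []] := (wP i).2; first by exists n.
exists (sigL (K m) x).
  apply: NL => /=; apply: BP.
  have Bi : (B <= i)%N by rewrite leqNgt; apply/negP => /aM; lia.
  by have := ge_id i; lia.
by rewrite /ev /sigL /= /x (block_index_inj ai (idxP _) mi).
Qed.

(** * Two staggered block partitions *)

Lemma fast_growth (h : nat -> nat) :
  {homo h : m n / (m <= n)%N} -> (forall B, exists n, (B <= h n)%N) ->
  exists p : nat -> nat, [/\ p 0%N = 0%N, forall k, (p k < p k.+1)%N &
    forall k, (2 ^ k.+1 * (h (p k)).+1 <= h (p k.+1 - p k))%N].
Proof.
move=> h_incr h_unb.
have /choice[g gP] : forall k, exists n, (2 ^ k.+1 * (h k).+1 <= h n)%N.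
  by move=> k; exact: h_unb.
pose p k := iter k (fun q => q + (g q).+1)%N 0%N.
have pS k : p k.+1 = (p k + (g (p k)).+1)%N by [].
have pk k : (k <= p k)%N by elim: k => // k IH; rewrite pS; lia.
exists p; split=> // k; rewrite pS; first lia.
rewrite addKn (leq_trans _ (h_incr _ _ (leqnSn _))) // (leq_trans _ (gP _)) //.
by rewrite leq_mul2r leq_exp2l // ltnS pk orbT.
Qed.

Theorem theorem26 (R : realType) (h : nat -> nat)
    (h_incr : {homo h : m n / (m <= n)%N})
    (h_limsup : limn_esup (fun n => ((h n)%:R : R)%:E) = +oo%E) :
  ~ is_ideal (fE R h).
Proof.
move=> [_ unionP].
have [p [p0 pS ph]] := fast_growth h_incr (limn_esup_pinfty_unbounded h_limsup).
(* b selects the family of blocks.  The truncated subtraction makes the first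
   block of the second family start at p 0 = 0. *)
pose a (b : bool) i := p (i.*2 - b)%N.
pose c (b : bool) i := h (p (i.*2.+1 - b)%N).
have pM := homo_leq leqnn leq_trans (fun i => ltnW (pS i)).
have a0 b : a b 0%N = 0%N by rewrite /a sub0n.
have aS b i : (a b i < a b i.+1)%N.
  apply: (homo_ltn ltn_trans pS); lia.
have F_fE b : fE R h (block_constant (a b) (c b)).
  apply: block_constant_fE => // i.
  pose k := (i.*2.+1 - b)%N.
  have kS : (i.+1.*2 - b)%N = k.+1 by rewrite /k; lia.
  apply: leq_trans (leq_trans (ph k) _).
    by rewrite leq_mul2r leq_exp2l // /k; apply/orP; right; lia.
  apply: h_incr; rewrite /a kS; apply: leq_sub2l; apply: pM; rewrite /k; lia.
have : fE R h (\bigcup_(A in range (fun b => block_constant (a b) (c b))) A).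
  by apply: unionP; [exact: finite_image|move=> _ [b _ <-]].
move=> [K [L [[[Kcov _ Kne] Kint] Lsum FL]]].
have /choice[e eP] : forall n, exists e, K n e /\ K n `<=` `I_e.+1.
  move=> n; have [u [v Kn]] := Kint n; have [k] := Kne n Logic.I.
  rewrite Kn /= => ukv; exists v.-1; split=> [|j] /=; lia.
have term_ge0 n :
    (0 <= counting (L n) / ((h #|` fset_set (K n)|)%:R : R)%:E)%E.
  by rewrite mule_ge0 ?counting_ge0 // inve_ge0 lee_fin ler0n.
have [N NP] := nneseries_lty_terms_lt term_ge0 Lsum ltr01.
have /choice[M MP] : forall b, exists M, forall n i, (M <= e n)%N ->
    (a b i <= e n < a b i.+1)%N -> `I_(c b i).+1 #<= L n.
  move=> b; apply: capture_block_constant => //; first by move=> n; exact: (eP n).1.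
  by move=> x xF; apply: FL; exists (block_constant (a b) (c b)) => //; exists b.
have [M' M'P] := late_index_of_large_value e N.
pose top := maxn M' (maxn (M true) (M false)).
have [n Kn] : exists n, K n top.
  by have : [set: nat] top by []; rewrite -Kcov => -[n _ ?]; exists n.
have le_top : (top <= e n)%N by have := (eP n).2 _ Kn.
have [k ek] := block_index (e n) p0 pS.
(* p k is the left end of block uphalf k of the family given by the parity
   of k, and p k.+1 is the last point of the sequence p in that block. *)
have oddk : (uphalf k).*2 = (k + odd k)%N by lia.
have ka : a (odd k) (uphalf k) = p k by rewrite /a oddk addnK.
have kaS : (p k.+1 <= a (odd k) (uphalf k).+1)%N.
  by apply: pM; rewrite doubleS oddk; lia.
have kc : c (odd k) (uphalf k) = h (p k.+1).
  by rewrite /c oddk -addSn addnK.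
have : `I_(c (odd k) (uphalf k)).+1 #<= L n.
  apply: MP; last by rewrite ka; lia.
  by apply: leq_trans le_top; rewrite /top; case: (odd k); lia.
have Ln : L n #<= `I_(h #|` fset_set (K n)|).
  apply: (@counting_ratio_lt1 R); apply: NP; apply: M'P; lia.
move=> /card_le_trans /(_ Ln); rewrite card_le_II kc.
apply/negP; rewrite -ltnNge ltnS; apply: h_incr.
apply: leq_trans (_ : (e n).+1 <= _)%N; last lia.
exact: geq_card_fset_set (subset_card_le (eP n).2).
Qed.
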